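(* Let $(X,\sim)$ be a partially ordered set and define $x<y$ iff $x\sim y$ and $\neg(x=y)$. Assume that for all $x,y\in X$, $\neg(y<x)$ implies $x\sim y$. Then: (1) for all $x,y\in X$, $x\leq_{P}y$ implies $x\sim y$; (2) for all $x,y\in X$, $x\leq_{P}y$ and $y\leq_{P}x$ imply $x=y$.
   Context: The setting is constructive mathematics: no use of the law of excluded middle. A partially ordered set is a set $X$ with a binary relation $\sim$ (respecting equality) that is reflexive ($x\sim x$), transitive ($x\sim y$ and $y\sim z$ imply $x\sim z$) and antisymmetric ($x\sim y$ and $y\sim x$ imply $x=y$). For the relation $<$, $x\leq_{P}y$ means that for all $z\in X$, $z<x$ implies $z<y$, and $y<z$ implies $x<z$. *)

(* Defs.v *)
From Stdlib Require Export Relation_Definitions RelationClasses Morphisms.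

(* A set is a Bishop set: a type together with an equivalence relation [eqX]
   as its equality.  Taking [eqX := eq] gives Leibniz equality. *)
Record is_partial_order {X : Type} (eqX sim : relation X) : Prop := {
  po_equality : Equivalence eqX;
  po_respects : Proper (eqX ==> eqX ==> iff) sim;
  po_refl : Reflexive sim;
  po_trans : Transitive sim;
  po_antisym : Antisymmetric X eqX sim
}.

Definition strict {X : Type} (eqX sim : relation X) : relation X :=
  fun x y => sim x y /\ ~ eqX x y.

Definition leP {X : Type} (lt : relation X) : relation X :=
  fun x y => forall z : X, (lt z x -> lt z y) /\ (lt y z -> lt x z).

(* Main.v *)
Require Import Defs.

(** By [Hneg], the positive statement [sim x y] only needs a refutation of y < x, so no excluded
    middle enters. Since [leP] moves lower bounds of x to y, y < x would yield y < y, against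
    irreflexivity. Part (2) is then antisymmetry of [sim]. *)

Theorem theorem14 (X : Type) (eqX sim : X -> X -> Prop)
    (Hpo : is_partial_order eqX sim)
    (Hneg : forall x y : X, ~ strict eqX sim y x -> sim x y) :
  (forall x y : X, leP (strict eqX sim) x y -> sim x y) /\
  (forall x y : X, leP (strict eqX sim) x y -> leP (strict eqX sim) y x ->
     eqX x y).
Proof.
  destruct Hpo as [Heq _ _ _ Hanti].
  assert (Hle : forall x y : X, leP (strict eqX sim) x y -> sim x y).
  { intros x y Hxy. apply Hneg. intros Hyx.
    (* The witness is z := y, in the half of [leP] about elements below; [Hirrefl] is then
       [~ eqX y y]. *)
    destruct (proj1 (Hxy y) Hyx) as [_ Hirrefl].
    apply Hirrefl. reflexivity. }
  split; [exact Hle |].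
  intros x y Hxy Hyx. apply Hanti; apply Hle; assumption.
Qed.
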